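(* For any symmetric probability measure $\mu$ on $\mathbb{R}$ with finite variance, $$\Gamma(\mu|\mathrm{b})\le\frac12\Psi(\mu|\mathrm{b}).$$
   Context: $\mathrm{b}=\frac12\delta_{-1}+\frac12\delta_{1}$ is the Rademacher distribution. For a symmetric probability measure $\mu$ on $\mathbb{R}$, the Boolean entropy and the Boolean Fisher information of $\mu$ relative to $\mathrm{b}$ are $$\Gamma(\mu|\mathrm{b})=\frac12\int x^2\,d\mu(x)-\int\log|x|\,d\mu(x)-\frac12\in[0,+\infty],$$ $$\Psi(\mu|\mathrm{b})=\iint\frac{\log x^2-\log y^2}{x^2-y^2}\,d\mu(x)\,d\mu(y)+\int x^2\,d\mu(x)-2\in[0,+\infty],$$ where the integrand of the double integral is understood with its continuous extension on the diagonal $x^2=y^2$ (value $1/x^2$, and $+\infty$ if $x=0$ or $y=0$). *)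

(* Defs.v *)
From HB Require Import structures.
From mathcomp Require Import all_boot all_order all_algebra.
From mathcomp Require Import all_classical all_reals all_analysis.

Set Implicit Arguments.
Unset Strict Implicit.
Unset Printing Implicit Defensive.

Import Order.TTheory GRing.Theory Num.Theory.
Import numFieldNormedType.Exports.

Local Open Scope classical_set_scope.
Local Open Scope ring_scope.
Local Open Scope ereal_scope.

Definition symmetric_law (R : realType)
    (mu : probability (measurableTypeR R) R) : Prop :=
  forall A : set (measurableTypeR R), measurable A ->
    mu ((fun x : R => (- x)%R) @^-1` A) = mu A.

Definition second_moment (R : realType)
    (mu : probability (measurableTypeR R) R) : \bar R :=
  \int[mu]_x ((x : R) ^+ 2)%:E.

(* [lne 0 = -oo], so an atom at 0 gives entropy +oo.  The value is meaningful
   when the variance is finite; otherwise both integrals may be +oo. *)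
Definition boolean_entropy (R : realType)
    (mu : probability (measurableTypeR R) R) : \bar R :=
  (2^-1)%:E * second_moment mu - \int[mu]_x lne (`|(x : R)|%:E) - (2^-1)%:E.

Definition log_quotient (R : realType) (x y : R) : \bar R :=
  if (x == 0%R) || (y == 0%R) then +oo
  else if (x ^+ 2 == y ^+ 2)%R then ((x ^+ 2)^-1)%:E
  else ((ln (x ^+ 2) - ln (y ^+ 2)) / (x ^+ 2 - y ^+ 2))%:E.

(* [log_quotient] is nonnegative, so by Tonelli the iterated integral is the
   integral with respect to the product measure. *)
Definition boolean_fisher_information (R : realType)
    (mu : probability (measurableTypeR R) R) : \bar R :=
  \int[mu]_y \int[mu]_x log_quotient x y + second_moment mu - 2%:E.

(* Main.v *)
(* Put u = x^2, v = y^2.  The logarithmic quotient has the representation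
     (log u - log v) / (u - v)
       = \int_0^1 dr / ((1 - r + r u) (1 - r + r v)),
   so with G(r) = E[1 / (1 - r + r X^2)] the double integral in the Fisher
   information is \int_0^1 G(r)^2 dr.  From G^2 >= 2 G - 1 it is at least
   2 E[log X^2 / (X^2 - 1)] - 1, and the elementary bound
   log u / (u - 1) >= 1 - (log u) / 2 turns this into 1 - 2 E[log |X|], which is
   the claim once the second moments are cancelled. *)
Require Import Defs.
From HB Require Import structures.
From mathcomp Require Import all_boot all_order all_algebra.
From mathcomp Require Import all_classical all_reals all_analysis.
From mathcomp Require Import measurable_realfun ring lra.

Set Implicit Arguments.
Unset Strict Implicit.
Unset Printing Implicit Defensive.

Import Order.TTheory GRing.Theory Num.Theory.
Import numFieldNormedType.Exports.

Local Open Scope classical_set_scope.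
Local Open Scope ring_scope.
Local Open Scope ereal_scope.

(** * The resolvent: positivity and measurability *)

(* For 0 <= r <= 1 and x != 0 this is 1 / (1 - r + r x^2).  Writing the inverse
   as exp (- ln _) makes it positive for every real r, and the value +oo at
   x = 0 matches that of [log_quotient], so that [log_quotientE] below holds
   without exception. *)
Definition resolvent (R : realType) (x r : R) : \bar R :=
  if x == 0%R then +oo else (expR (- ln (1 - r + r * x ^+ 2)))%:E.

Lemma resolvent_gt0 (R : realType) (x r : R) : 0 < resolvent x r.
Proof. by rewrite /resolvent; case: ifP => // _; rewrite lte_fin expR_gt0. Qed.

Lemma measurable_resolvent (R : realType) :
  measurable_fun [set: measurableTypeR R * measurableTypeR R]
    (fun z => resolvent (z.1 : R) (z.2 : R) : \bar R).
Proof.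
apply: measurable_fun_ifT => //; first exact: measurable_fun_eqr.
apply/measurable_EFinP; apply: measurableT_comp => //.
apply: measurableT_comp => //; apply: measurableT_comp => //.
apply: measurable_funD; first exact: measurable_funB.
by apply: measurable_funM => //; exact: measurable_funX.
Qed.

Lemma affine_gt0 (R : realType) (w r : R) :
  (0 < w)%R -> (0 <= r <= 1)%R -> (0 < 1 - r + r * w)%R.
Proof.
move=> w0 /andP[r0 r1].
have [->|r1'] := eqVneq r 1%R; first by rewrite subrr add0r mul1r.
apply: ltr_pwDl; last by rewrite mulr_ge0// ltW.
by rewrite subr_gt0 lt_neqAle r1'.
Qed.

Lemma resolvent_neq0 (R : realType) (x r : R) :
  x != 0%R -> (0 <= r <= 1)%R ->
  resolvent x r = ((1 - r + r * x ^+ 2)^-1)%:E /\ (0 < 1 - r + r * x ^+ 2)%R.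
Proof.
move=> x0 rI; have A0 : (0 < 1 - r + r * x ^+ 2)%R.
  by rewrite affine_gt0// exprn_even_gt0.
by split => //; rewrite /resolvent (negbTE x0) expRN lnK.
Qed.

(** * Rational bounds for the logarithm *)

Lemma le_2ln_div (R : realType) (u : R) :
  (1 <= u)%R -> (2 * (u - 1) / (u + 1) <= ln u)%R.
Proof.
(* Since 2(u - 1)/(u + 1) = 2 - 4/(u + 1), [g] is the difference of the two sides. It vanishes at 1,
   and its derivative [g'] is nonnegative on [1, +oo). *)
move=> u1; pose g (x : R) := (ln x - 2 + 4 * (x + 1)^-1)%R.
pose g' (x : R) := ((x - 1) ^+ 2 / (x * (x + 1) ^+ 2))%R.
have dg (x : R) : (1 <= x)%R -> is_derive x (1 : R)%R g (g' x).
  move=> x1; have x0 : (0 < x)%R by lra.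
  have x10 : (x + 1 != 0)%R by rewrite gt_eqF//; lra.
  have dl : is_derive x (1 : R)%R (@ln R) x^-1%R by exact: is_derive1_ln.
  have -> : g = (@ln R - cst 2 + 4 \*: (fun y : R => (y + 1)^-1))%R by [].
  apply: is_derive_eq.
  rewrite /g' /GRing.scale/=; field.
  by rewrite x10 gt_eqF.
suff : (g 1 <= g u)%R.
  have -> : (2 * (u - 1) / (u + 1) = 2 - 4 * (u + 1)^-1)%R.
    by field; rewrite gt_eqF//; lra.
  have -> : g 1%R = 0%R by rewrite /g ln1; field.
  by rewrite /g; lra.
apply: (@ger0_derive1_ndecry _ g 1) => //.
- by move=> x; rewrite in_itv/= andbT => /ltW /dg [].
- move=> x; rewrite in_itv/= andbT => x1.
  rewrite derive1E; have [_ ->] := dg _ (ltW x1).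
  by rewrite /g' divr_ge0 ?sqr_ge0// mulr_ge0 ?sqr_ge0//; lra.
- apply: derivable_within_continuous => x; rewrite in_itv/= andbT => x1.
  by have [] := dg _ x1.
Qed.

Lemma one_subr_half_ln_le (R : realType) (u : R) :
  (0 < u)%R -> u != 1%R -> (1 - ln u / 2 <= ln u / (u - 1))%R.
Proof.
(* After multiplication by v - 1 > 0 this is (ln v)(v + 1)/2 >= v - 1, which is [le_2ln_div]. *)
have main (v : R) : (1 < v)%R -> (1 - ln v / 2 <= ln v / (v - 1))%R.
  move=> v1; have /= := @le_2ln_div _ v (ltW v1).
  rewrite ler_pdivrMr; last lra.
  move=> h; rewrite ler_pdivlMr; last lra.
  by lra.
move=> u0 u1.
have [h|h|h] := ltgtP u 1%R; [|exact: main|by rewrite h eqxx in u1].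
(* For u < 1 the inequality at 1/u gives the one at u: inversion adds ln u to the right side and
   turns - ln u / 2 into + ln u / 2. *)
have := main (u^-1)%R; rewrite invf_gt1// => /(_ h); rewrite lnV//.
have -> : (- ln u / (u^-1 - 1) = ln u / (u - 1) + ln u)%R.
  by field; rewrite subr_eq0 u1 !gt_eqF//; lra.
lra.
Qed.

(** * Integral representation of the logarithmic quotient *)

Lemma integral_inv_affine2 (R : realType) (u v : R) : (0 < u)%R -> (0 < v)%R ->
  \int[@lebesgue_measure R]_(r in `[0%R, 1%R])
    (((1 - r + r * u) * (1 - r + r * v))^-1)%:E =
  (if u == v then u^-1 else (ln u - ln v) / (u - v))%:E.
Proof.
move=> u0 v0.
have A0 (w r : R) : (0 < w)%R -> r \in `[0%R, 1%R] -> (0 < 1 - r + r * w)%R.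
  by rewrite in_itv/=; exact: affine_gt0.
have dA (w r : R) :
    is_derive r (1 : R)%R (fun r : R => 1 - r + r * w)%R (w - 1)%R.
  rewrite (_ : (fun _ => _) = (cst 1 - id + w \*: id)%R); last first.
    by apply/funext => s; rewrite mulrC.
  apply: is_derive_eq.
  by rewrite /GRing.scale/=; ring.
have ftc (F : R -> R) :
    (forall r : R, r \in `[0%R, 1%R] -> is_derive r (1 : R)%R F
      ((1 - r + r * u) * (1 - r + r * v))^-1%R) ->
    \int[@lebesgue_measure R]_(r in `[0%R, 1%R])
      (((1 - r + r * u) * (1 - r + r * v))^-1)%:E = (F 1%R - F 0%R)%:E.
  move=> dF.
  have cF (r : R) : r \in `[0%R, 1%R] -> {for r, continuous F}.
    by move=> /dF [dFr _]; apply/differentiable_continuous/derivable1_diffP.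
  rewrite (@continuous_FTC2 _ _ F)//.
  - apply: derivable_within_continuous => r rI.
    have uI := A0 _ _ u0 rI; have vI := A0 _ _ v0 rI.
    have p0 : ((1 - r + r * u) * (1 - r + r * v) != 0)%R.
      by rewrite mulf_neq0// gt_eqF.
    have d := is_deriveM (dA u r) (dA v r).
    by have [] := @is_deriveV _ (fun r : R => (1 - r + r * u) * (1 - r + r * v))%R
      _ _ _ p0 d.
  - split.
    + move=> r rI; have [] // := dF r; exact: subset_itv_oo_cc.
    + by apply/cvg_at_right_filter/cF; rewrite in_itv/= lexx ler01.
    + by apply/cvg_at_left_filter/cF; rewrite in_itv/= lexx ler01.
  - move=> r rI; rewrite derive1E; have [] // := dF r.
    exact: subset_itv_oo_cc.
have [uv|uv] := eqVneq u v.
  subst v.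
  (* The numerator of F' is (1 - r + r u) - r (u - 1) = 1, so F is a primitive of the inverse
     square. *)
  pose F (r : R) := (r / (1 - r + r * u))%R.
  transitivity ((F 1 - F 0)%:E : \bar R)%R; last first.
    by rewrite /F !(oppr0, mul0r, subrr, mul1r, add0r, subr0, addr0).
  apply: ftc.
  move=> r rI; have vI := A0 _ _ u0 rI.
  have v1 : (1 - r + r * u != 0)%R by rewrite gt_eqF.
  have dV : is_derive r (1 : R)%R (fun r : R => (1 - r + r * u)^-1)%R
      (- (1 - r + r * u) ^- 2 * (u - 1))%R.
    exact: (@is_deriveV _ (fun r : R => 1 - r + r * u)%R _ _ _ v1 (dA u r)).
  have -> : F = (id * (fun r : R => (1 - r + r * u)^-1))%R by [].
  apply: is_derive_eq.
  by rewrite /GRing.scale/=; field.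
(* Primitive obtained by partial fractions: (u - 1)(1 - r + r v) - (v - 1)(1 - r + r u) = u - v. *)
pose F (r : R) := ((ln (1 - r + r * u) - ln (1 - r + r * v)) / (u - v))%R.
transitivity ((F 1 - F 0)%:E : \bar R)%R; last first.
  by rewrite /F !(oppr0, mul0r, subrr, mul1r, add0r, subr0, addr0, ln1).
apply: ftc.
move=> r rI.
have dl (w : R) : (0 < w)%R ->
  is_derive r (1 : R)%R (fun r : R => ln (1 - r + r * w))
    ((1 - r + r * w)^-1 * (w - 1))%R.
  move=> w0; have wI := A0 _ _ w0 rI.
  exact: (@is_derive1_comp _ (@ln R) (fun r : R => 1 - r + r * w)%R r _ _
    (is_derive1_ln wI) (dA w r)).
have du := dl _ u0; have dv := dl _ v0.
have -> : F =
  ((u - v)^-1 \*: ((fun r : R => ln (1 - r + r * u)) -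
     (fun r : R => ln (1 - r + r * v))))%R.
  by apply/funext => s; rewrite /F mulrC.
apply: is_derive_eq.
rewrite /GRing.scale/=; field.
by rewrite subr_eq0 uv !gt_eqF ?A0.
Qed.

Lemma measurable_resolvent1 (R : realType) (x : R) :
  measurable_fun setT (fun r : measurableTypeR R => resolvent x r).
Proof.
exact: (measurableT_comp (@measurable_resolvent R) (pair1_measurable x)).
Qed.

Lemma resolvent1 (R : realType) (r : R) : resolvent 1 r = 1.
Proof. by rewrite /resolvent oner_eq0 expr1n mulr1 subrK ln1 oppr0 expR0. Qed.

Lemma resolvent0 (R : realType) (r : R) : resolvent 0 r = +oo.
Proof. by rewrite /resolvent eqxx. Qed.

(** For fixed r the integrand is a product of a function of x and a function of y, which is what
    lets the double integral collapse to a square. If x or y is 0, both sides are +oo because the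
    other resolvent is positive. *)
Lemma log_quotientE (R : realType) (x y : R) :
  log_quotient x y =
  \int[uniform_prob (@ltr01 R)]_r (resolvent x r * resolvent y r).
Proof.
have mres z := @measurable_resolvent1 R z.
rewrite /log_quotient.
have infty z : \int[uniform_prob (@ltr01 R)]_r (+oo * resolvent z r) = +oo.
  transitivity (\int[uniform_prob (@ltr01 R)]_r (cst +oo r : \bar R)).
    by apply: eq_integral => r _; rewrite gt0_mulye// resolvent_gt0.
  by rewrite integral_cst//= probability_setT mule1.
have [->|x0] := eqVneq x 0%R.
  by under eq_integral do rewrite resolvent0; rewrite infty.
have [->|y0] := eqVneq y 0%R.
  by under eq_integral do rewrite resolvent0 muleC; rewrite infty.
rewrite integral_uniform; last 2 first.
- exact: emeasurable_funM.
- by move=> r; rewrite mule_ge0// ltW// resolvent_gt0.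
rewrite subr0 invr1 mul1e.
under eq_integral => r.
  rewrite inE/= in_itv/= => rI.
  rewrite (resolvent_neq0 x0 rI).1 (resolvent_neq0 y0 rI).1 -EFinM -invfM.
  over.
by rewrite integral_inv_affine2 ?exprn_even_gt0//; case: ifP.
Qed.

(** This is [one_subr_half_ln_le] at u = x^2, where ln u = 2 ln |x|. At x = 0 the right side is +oo,
    and at x^2 = 1 both sides equal 1. *)
Lemma one_sub_lne_le_log_quotient (R : realType) (x : R) :
  1 - lne `|x|%:E <= log_quotient x 1.
Proof.
rewrite /log_quotient oner_eq0 orbF.
have [->|x0] := eqVneq x 0%R; first exact: leey.
rewrite lne_EFin ?normr_gt0// expr1n ln1 subr0.
have lnx : ln (x ^+ 2) = (ln `|x| * 2)%R.
  by rewrite -real_normK ?num_real// lnXn ?normr_gt0// mulr_natr.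
case: ifPn => [/eqP x1|x1].
  by move: lnx; rewrite x1 ln1 invr1 -EFinB lee_fin => ?; lra.
have := @one_subr_half_ln_le R (x ^+ 2)%R.
by rewrite -EFinB lee_fin exprn_even_gt0// lnx mulfK// => /(_ x0 x1).
Qed.

(** * Tonelli and the lower bound for the double integral *)

Section double_integral.
Context (R : realType) (mu : probability (measurableTypeR R) R).

Let U := uniform_prob (@ltr01 R).

Let G (r : R) : \bar R := \int[mu]_x resolvent x r.

Let mres_mul (c : R -> \bar R) : measurable_fun setT c ->
  measurable_fun [set: measurableTypeR R * measurableTypeR R]
    (fun z => resolvent (z.1 : R) (z.2 : R) * c z.2 : \bar R).
Proof.
move=> mc; apply: emeasurable_funM; first exact: measurable_resolvent.
exact: measurableT_comp.
Qed.

Let mG : measurable_fun setT G.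
Proof.
apply: (@measurable_fun_fubini_tonelli_G _ _ _ _ _ mu _
  (@measurable_resolvent R)) => z.
by rewrite ltW// resolvent_gt0.
Qed.

Let G0 r : 0 <= G r.
Proof. by apply: integral_ge0 => x _; rewrite ltW// resolvent_gt0. Qed.

(** The weight [c] is later taken to be [resolvent 1], which is constantly 1, then [G], then
    [resolvent y]. *)
Let swap (c : R -> \bar R) : measurable_fun setT c -> (forall r, 0 <= c r) ->
  \int[mu]_x \int[U]_r (resolvent x r * c r) = \int[U]_r (G r * c r).
Proof.
move=> mc c0.
rewrite (@fubini_tonelli _ _ _ _ _ mu (uniform_prob (@ltr01 R)) _ (mres_mul mc)).
2: by move=> z; rewrite mule_ge0// ltW// resolvent_gt0.
apply: eq_integral => r _; rewrite /G muleC -ge0_integralZl//.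
- by apply: eq_integral => x _; rewrite muleC.
- exact: (measurableT_comp (@measurable_resolvent R) (pair2_measurable r)).
- by move=> x _; rewrite ltW// resolvent_gt0.
Qed.

(** By [swap] the two integrals are those of G and G^2, so the claim is the integral of 2 G <= G^2 +
    1. The additive form avoids subtracting infinite values. *)
Lemma log_quotient1_le_double_integral :
  2%:E * (\int[mu]_x log_quotient x 1) <=
  \int[mu]_y \int[mu]_x log_quotient x y + 1.
Proof.
have -> : \int[mu]_x log_quotient x 1 = \int[U]_r G r.
  under eq_integral do rewrite log_quotientE.
  rewrite swap//; last by move=> r; rewrite ltW// resolvent_gt0.
    by apply: eq_integral => r _; rewrite resolvent1 mule1.
  exact: measurable_resolvent1.
have -> : \int[mu]_y \int[mu]_x log_quotient x y = \int[U]_r (G r * G r).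
  rewrite -swap//; apply: eq_integral => y _.
  under eq_integral do rewrite log_quotientE.
  rewrite swap//; last by move=> r; rewrite ltW// resolvent_gt0.
    by apply: eq_integral => r _; rewrite muleC.
  exact: measurable_resolvent1.
have <- : \int[U]_r (cst 1 r : \bar R) = 1.
  by rewrite integral_cst//= probability_setT mule1.
rewrite -ge0_integralZl// -ge0_integralD//; last 2 first.
- by move=> r _; rewrite mule_ge0.
- exact: emeasurable_funM.
apply: ge0_le_integral => //.
- by move=> r _; rewrite mule_ge0.
- exact: measurable_funeM.
- by apply: emeasurable_funD => //; exact: emeasurable_funM.
(* For finite G(r) = g the gap is (g - 1)^2; for infinite G(r) the right side is +oo. *)
move=> r _ /=; have := G0 r; case: (G r) => [g| |]//= g0.
  rewrite -!EFinM -EFinD lee_fin -subr_ge0.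
  by rewrite (_ : _ - _ = (g - 1) ^+ 2)%R ?sqr_ge0//; ring.
by rewrite mulyy addye// leey.
Qed.

End double_integral.

(** * Logarithmic moment, second moment and conclusion *)

Lemma measurable_lne_norm (R : realType) :
  measurable_fun setT (fun x : measurableTypeR R => lne `|x : R|%:E : \bar R).
Proof.
have -> : (fun x : R => lne `|x|%:E) =
    (fun x => if x == 0%R then -oo else (ln `|x|)%:E).
  apply/funext => x; have [->|x0] := eqVneq x 0%R.
    by rewrite normr0 le0_lneNy.
  by rewrite lne_EFin// normr_gt0.
apply: measurable_fun_ifT => //; first exact: measurable_fun_eqr.
by apply/measurable_EFinP; exact: measurableT_comp.
Qed.

(** With c the real part [fine] of the mean, x^2 <= 2 (x - c)^2 + 2 c^2, the gap being (x - 2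
    c)^2. *)
Lemma second_moment_fin_num (R : realType)
    (mu : probability (measurableTypeR R) R) :
  variance mu (fun x : R => x) < +oo -> second_moment mu \is a fin_num.
Proof.
rewrite /variance unlock unlock; set c := fine _ => var_fin.
rewrite ge0_fin_numE; last by apply: integral_ge0 => x _; rewrite lee_fin sqr_ge0.
have mc : measurable_fun setT
    (fun x : measurableTypeR R => (((x : R) - c) * ((x : R) - c))%:E : \bar R).
  by apply/measurable_EFinP; apply: measurable_funM; exact: measurable_funB.
apply: (@le_lt_trans _ _ (\int[mu]_x
    (2%:E * (((x : R) - c) * ((x : R) - c))%:E + (2 * c ^+ 2)%:E))).
  apply: ge0_le_integral => //.
  - by move=> x _; rewrite lee_fin sqr_ge0.
  - by apply/measurable_EFinP; exact: measurable_funX.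
  - by apply: emeasurable_funD => //; exact: measurable_funeM.
  - move=> x _; rewrite -EFinM -EFinD lee_fin -subr_ge0.
    by rewrite (_ : _ - _ = (x - 2 * c) ^+ 2)%R ?sqr_ge0//; ring.
rewrite ge0_integralD//; last 3 first.
- by move=> x _; rewrite -EFinM lee_fin -expr2 mulr_ge0// sqr_ge0.
- exact: measurable_funeM.
- by move=> x _; rewrite lee_fin mulr_ge0// sqr_ge0.
rewrite ge0_integralZl//; last by move=> x _; rewrite lee_fin -expr2 sqr_ge0.
rewrite (@integral_cst _ _ _ mu _ measurableT (2 * c ^+ 2)%:E) lte_add_pinfty//.
  by rewrite lte_mul_pinfty.
by have /= -> := @probability_setT _ _ _ mu; rewrite mule1 ltry.
Qed.

Theorem theorem1p16 (R : realType) (mu : probability (measurableTypeR R) R)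
    (mu_sym : symmetric_law mu)
    (mu_var : variance mu (fun x : R => x) < +oo) :
  boolean_entropy mu <= (2^-1)%:E * boolean_fisher_information mu.
Proof.
have mlne := @measurable_lne_norm R.
set f := fun x : measurableTypeR R => lne `|x : R|%:E : \bar R.
have m_fin := second_moment_fin_num mu_var.
(* The representation at y = 1 is the integral of a single resolvent, so measurability in x comes
   from Tonelli. *)
have mlq1 : measurable_fun setT (fun x : measurableTypeR R => log_quotient x 1).
  rewrite (_ : (fun _ => _) =
      (fun x => \int[uniform_prob (@ltr01 R)]_r resolvent x r)); last first.
    apply/funext => x; rewrite log_quotientE.
    by apply: eq_integral => r _; rewrite resolvent1 mule1.
  apply: (@measurable_fun_fubini_tonelli_F _ _ _ _ _ (uniform_prob (@ltr01 R)) _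
    (@measurable_resolvent R)) => z.
  by rewrite ltW// resolvent_gt0.
have lq0 (x y : R) : 0 <= log_quotient x y.
  rewrite log_quotientE; apply: integral_ge0 => r _.
  by rewrite mule_ge0// ltW// resolvent_gt0.
(* Pointwise ln |x| <= |x| - 1 <= x^2. Hence the positive part of the log-moment is finite, and only
   its negative part can be infinite. *)
have P_le : \int[mu]_x f^\+ x <= second_moment mu.
  apply: ge0_le_integral => //.
  - exact: measurable_funepos.
  - by apply/measurable_EFinP; exact: measurable_funX.
  move=> x _; rewrite funeposE ge_max lee_fin sqr_ge0 andbT /f.
  have [->|x0] := eqVneq (x : R) 0%R.
    by rewrite normr0 le0_lneNy// leNye.
  have x1 : (0 < `|x|)%R by rewrite normr_gt0.
  rewrite lne_EFin// lee_fin -real_normK ?num_real//.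
  have : (ln `|x| <= `|x| - 1)%R.
    by rewrite -{1}(subrK 1 `|x|)%R addrC le_ln1Dx//; lra.
  nra.
(* Integrated form of [one_sub_lne_le_log_quotient], with the positive part moved to the right so
   that every integrand is nonnegative. *)
have NK : 1 + \int[mu]_x f^\- x <=
    \int[mu]_x log_quotient x 1 + \int[mu]_x f^\+ x.
  have <- : \int[mu]_x (cst 1 x : \bar R) = 1.
    by rewrite integral_cst//= probability_setT mule1.
  rewrite -!ge0_integralD//; last 2 first.
  - exact: measurable_funepos.
  - exact: measurable_funeneg.
  apply: ge0_le_integral => //.
  - by move=> x _; rewrite adde_ge0.
  - by apply: emeasurable_funD => //; exact: measurable_funeneg.
  - by apply: emeasurable_funD => //; exact: measurable_funepos.
  move=> x _ /=; have := one_sub_lne_le_log_quotient (x : R).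
  rewrite funeposE funenegE /f; move: (lne _) (log_quotient _ _) (lq0 x 1%R).
  move=> [l| |] [q| |] //= _.
  - rewrite -!EFin_max -!EFinD !lee_fin.
    by have [] := leP (- l)%R 0%R; have [] := leP l 0%R; lra.
  - by move=> _; rewrite addye ?leey// -EFin_max.
  - by move=> _; rewrite maxye addey// leey.
  - by move=> _; rewrite maxye addey// leey.
  - by move=> _; rewrite maxNye addye// leey.
have KI := log_quotient1_le_double_integral mu.
have fE : \int[mu]_x lne `|x : R|%:E = \int[mu]_x f^\+ x - \int[mu]_x f^\- x.
  exact: integralE.
rewrite /boolean_entropy /boolean_fisher_information fE.
have P0 : 0 <= \int[mu]_x f^\+ x by exact: integral_ge0.
have N0 : 0 <= \int[mu]_x f^\- x by exact: integral_ge0.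
have I0 : 0 <= \int[mu]_y \int[mu]_x log_quotient x y.
  by apply: integral_ge0 => y _; apply: integral_ge0.
have K0 : 0 <= \int[mu]_x log_quotient x 1 by exact: integral_ge0.
move: m_fin P_le NK KI P0 N0 I0 K0.
move: (second_moment mu) (\int[mu]_x f^\+ x) (\int[mu]_x f^\- x)
  (\int[mu]_x log_quotient x 1) (\int[mu]_y \int[mu]_x log_quotient x y).
(* If I = +oo the right side is +oo. Otherwise 2 K <= I + 1 makes K finite, and 1 + N <= K + P makes
   N finite. Then N - P <= K - 1 <= I/2 - 1/2, and the terms m/2 cancel. *)
move=> [m| |] [P| |] N K [I| |]//= _ P_le + + P0 + _; last first.
  by move=> _ _ _ _; rewrite gt0_muley ?leey// lte_fin invr_gt0.
case: K => [K| |]//; last by rewrite gt0_muley ?lte_fin.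
case: N => [N| |]//.
rewrite -!(EFinM, EFinD, EFinN, EFinB) !lee_fin => *; lra.
Qed.
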